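(* Let $\mathbb{K}$ be a field, let $A_1,\ldots,A_m \in \mathbb{K}^{n\times n}$, and let $A=\sum_{k=1}^m A_k x_k$ be the corresponding linear symbolic matrix. For every integer $d\ge 1$ and every $\ell\in\{0,1,\ldots,n\}$, the polytopes ${\cal P}^d_\ell(A)$, ${\cal P}^d(A)$ and ${\cal P}^{\le d}(A)$ are all integral polytopes.
   Context: Notation: $[n]=\{1,\ldots,n\}$, and $x_1,\ldots,x_m$ are indeterminates. For $I,J\subseteq[n]$, $A[I,J]$ is the submatrix of $A$ with row index set $I$ and column index set $J$; the determinant of the empty matrix is $1$. For a multivariate polynomial $p$, $\operatorname{supp} p$ denotes the set of exponent vectors of monomials appearing in $p$ with nonzero coefficient. For $d\ge 1$, the $d$-th blow-up of $A$ is $A^{\{d\}}=\sum_{k=1}^m A_k\otimes X_k$, where $X_k=(x_{k,ij})_{i,j\in[d]}$ is a $d\times d$ matrix whose entries $x_{k,ij}$ ($k\in[m]$, $i,j\in[d]$) are distinct commuting indeterminates, and $\otimes$ is the Kronecker product. For $I,J\subseteq [n]$, $A[I,J]^{\{d\}}=\sum_{k=1}^m A_k[I,J]\otimes X_k$. For $|I|=|J|$, $\det A[I,J]^{\{d\}}$ is a polynomial in the $x_{k,ij}$ over $\mathbb{K}$, so $\operatorname{supp}\det A[I,J]^{\{d\}}$ is a set of integer vectors $z=(z_{k,ij})_{k\in[m],i,j\in[d]}$. For such $z$ define $\operatorname{proj}_d(z)\in\mathbb{Q}^m_{\ge0}$ by $\operatorname{proj}_d(z)_k=\frac1d\sum_{i,j\in[d]}z_{k,ij}$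 for $k\in[m]$. For $d\ge1$ and $\ell\in\{0,\ldots,n\}$ put $${\cal S}^d_\ell=\bigcup_{I,J\subseteq[n]:\,|I|=|J|=\ell}\operatorname{proj}_d(\operatorname{supp}\det A[I,J]^{\{d\}})\subseteq\mathbb{Q}^m_{\ge0}.$$ With $\operatorname{Conv}$ denoting convex hull, define $${\cal P}^d_\ell(A)=\operatorname{Conv}{\cal S}^d_\ell,\quad {\cal P}^d(A)=\operatorname{Conv}\bigcup_{\ell=0}^n{\cal S}^d_\ell,\quad {\cal P}^{\le d}(A)=\operatorname{Conv}\bigcup_{f=1}^d\bigcup_{\ell=0}^n{\cal S}^f_\ell .$$ A polytope (possibly empty) in $\mathbb{R}^m$ is integral if each of its extreme points is an integer vector. *)

(* Defs.v *)
From HB Require Import structures.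
From mathcomp Require Import all_boot all_order all_algebra.
From mathcomp Require Import mpoly mxtens.
From mathcomp Require Import boolp classical_sets reals.

Set Implicit Arguments.
Unset Strict Implicit.
Unset Printing Implicit Defensive.

Import Order.TTheory GRing.Theory Num.Theory.

Local Open Scope classical_set_scope.
Local Open Scope ring_scope.

Section ConvexGeometry.
Context {R : realType} {m : nat}.
Implicit Types (S P : set 'rV[R]_m) (x : 'rV[R]_m).

(* Conv set0 = set0, since an empty sum of weights is not 1. *)
Definition Conv S : set 'rV[R]_m :=
  [set x | exists (r : nat) (w : 'I_r -> R) (p : 'I_r -> 'rV[R]_m),
     [/\ forall i, 0 <= w i, \sum_(i < r) w i = 1, forall i, S (p i)
       & x = \sum_(i < r) w i *: p i]].

Definition polytope P := exists s : seq 'rV[R]_m, P = Conv [set` s].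

Definition extreme_point P x :=
  P x /\ forall (y z : 'rV[R]_m) (t : R), P y -> P z -> 0 < t < 1 ->
    x = t *: y + (1 - t) *: z -> y = x /\ z = x.

Definition integral_polytope P :=
  polytope P /\
  forall x, extreme_point P x -> forall k : 'I_m, x 0 k \is a Num.int.

End ConvexGeometry.

Section BlowUp.
Context {K : fieldType} {m : nat}.

(* The indeterminates x_{k,ij} are numbered through an enumeration of the
   triples (k, i, j). *)
Definition nvars (m d : nat) : nat := #|{: 'I_m * 'I_d * 'I_d}|.

Definition xvar {m d : nat} (k : 'I_m) (i j : 'I_d) : 'I_(nvars m d) :=
  enum_rank (k, i, j).

Definition Xmx (d : nat) (k : 'I_m) : 'M[{mpoly K[nvars m d]}]_d :=
  \matrix_(i < d, j < d) 'X_(xvar k i j).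

(* [*t] is the Kronecker product *)
Definition blowup (p d : nat) (B : 'I_m -> 'M[K]_p) :
    'M[{mpoly K[nvars m d]}]_(p * d) :=
  \sum_(k < m) map_mx (@mpolyC (nvars m d) K) (B k) *t Xmx d k.

(* B[I,J] as a square matrix of size l = |I| = |J|, with rows and columns
   in increasing order: [enum_val] enumerates a set of ordinals increasingly. *)
Definition submat (n l : nat) (I J : {set 'I_n}) (hI : #|I| = l)
    (hJ : #|J| = l) (B : 'M[K]_n) : 'M[K]_l :=
  mxsub (fun i : 'I_l => enum_val (cast_ord (esym hI) i))
        (fun j : 'I_l => enum_val (cast_ord (esym hJ) j)) B.

End BlowUp.

(* The vector has rational entries; it is placed directly in R^m. *)
Definition proj (R : realType) (m d : nat) (z : 'X_{1..nvars m d}) :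
    'rV[R]_m :=
  \row_(k < m) (d%:R^-1 * \sum_(i < d) \sum_(j < d) (z (xvar k i j))%:R).

Section Polytopes.
Context {R : realType} {K : fieldType} {m n : nat}.
Implicit Types (A : 'I_m -> 'M[K]_n) (d l : nat).

Definition Sset A d l : set 'rV[R]_m :=
  [set v | exists (I J : {set 'I_n}) (hI : #|I| = l) (hJ : #|J| = l),
     exists2 z : 'X_{1..nvars m d},
       z \in msupp (\det (blowup d (fun k => submat hI hJ (A k))))
       & v = proj R z].

(* P^d_l(A), P^d(A) and P^{<=d}(A), for the linear symbolic matrix
   A = sum_k A_k x_k given by its coefficients A_k *)
Definition Pdl A d l : set 'rV[R]_m := Conv (Sset A d l).

Definition Pd A d : set 'rV[R]_m :=
  Conv (\bigcup_(l in [set l | (l <= n)%N]) Sset A d l).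

Definition Pled A d : set 'rV[R]_m :=
  Conv (\bigcup_(f in [set f | (1 <= f <= d)%N])
          \bigcup_(l in [set l | (l <= n)%N]) Sset A f l).

End Polytopes.

Arguments Sset R {K m n} A d l.
Arguments Pdl R {K m n} A d l.
Arguments Pd R {K m n} A d.
Arguments Pled R {K m n} A d.

(* Main.v *)
From HB Require Import structures.
Require Import Defs.
From mathcomp Require Import all_boot all_order all_fingroup all_algebra.
From mathcomp Require Import zify ring lra.
From mathcomp Require Import mxtens mpoly.
From mathcomp Require Import boolp classical_sets functions cardinality reals.

Set Implicit Arguments.
Unset Strict Implicit.
Unset Printing Implicit Defensive.

Import Order.TTheory GRing.Theory Num.Theory.
Local Open Scope ring_scope.

(** The integrality rests on a divisibility: for matrices [B_k] of size [l] and
    weights [c_k], the largest value of [sum_k c_k deg_k z] over the monomials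
    [z] of [det (sum_k B_k (x) X_k)] is a multiple of [d], where [deg_k] is the
    degree in the entries of [X_k] ([dvd_max_weight]).

    To see why, mark the blow-up by replacing each variable [x_{k,ij}] with
    [x_{k,ij} u^[j < i] t^(c_k)].  Distinct monomials stay distinct, so the
    [t]-degree of the marked determinant is the maximal weight.  The marked
    [d x d] blocks all satisfy [g a = sigma(a) g], where [sigma] shifts both
    indices of the variables cyclically and [g] is the cyclic matrix with
    corner entry [u].  The solutions of this equation form a ring: when there is
    at least one [X_k], and over the field of fractions of the polynomials in
    the variables and [u], it is a cyclic division algebra of degree [d].  Two
    of its properties carry the proof, and both hold within polynomial rings.
    - A nonzero solution [a] has nonzero determinant: with [u = w^d] and after
      conjugation by [diag (w^i)], the top [w]-coefficient of [a] has exactly one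
      nonzero entry in each row and column.  Applied to the top [t]-coefficient
      of a solution over the polynomials in [u] and [t], this also shows that
      the [t]-degree of its determinant is a multiple of [d]
      ([twisted_poly2_det_size]).
    - Solutions are stable under sums, products, adjugates of nonsingular
      solutions and scaling by their determinants, so block Gaussian elimination, made free of
      denominators, stays among them ([dvd_deg_det_pivot], [dvd_deg_det]).
    Hence the [t]-degree of a nonzero determinant of a matrix whose [d x d] blocks are
    solutions is a multiple of [d], like that of a single block.

    The rest is convex geometry.  The polytopes are hulls of finite sets, so
    an extreme point [v] is the projection of a monomial [z0] of some minor and,
    by Gordan's alternative, it is the unique maximizer of some linear form
    over the finite set ([extreme_exposed]).  On one minor the coordinates
    [deg_k z] have constant sum [l d], so this form can be shifted, scaled and
    rounded to natural weights [C], with a margin that lets every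
    [C + e_k] be maximal at [z0] as well ([nat_exposing]).  The divisibility for
    [C] and for [C + e_k] makes [deg_k z0] a multiple of [d], that is, [v_k] an
    integer. *)

(** * Determinants of monomial and of polynomial matrices *)

(** Multiplying by the transpose gives a diagonal matrix, which spares the
    computation of a sign. *)
Lemma det_monomial_neq0 (R : idomainType) d (M : 'M[R]_d) (f : 'I_d -> 'I_d) :
  injective f -> (forall i j, (M i j != 0) = (j == f i)) -> \det M != 0.
Proof.
move=> f_inj supM.
have M0 i j : j != f i -> M i j = 0 by rewrite -supM negbK => /eqP.
have diagE : M *m M^T = diag_mx (\row_i M i (f i) ^+ 2).
  apply/matrixP=> i j; rewrite !mxE (bigD1 (f i)) //= big1 => [|k /M0->]; last first.
    by rewrite mul0r.
  rewrite !mxE addr0; have [->|ne_ij] := eqVneq i j; first by rewrite expr2 mulr1n.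
  by rewrite [M j _]M0 ?mulr0 ?mulr0n // (inj_eq f_inj).
have : \det (M *m M^T) != 0.
  rewrite diagE det_diag prodf_seq_neq0; apply/allP=> i _ /=.
  by rewrite mxE expf_neq0 // supM.
by rewrite det_mulmx mulf_eq0 negb_or => /andP[].
Qed.

Lemma coef_mul_top (R : nzRingType) (p q : {poly R}) a b :
  (size p <= a.+1)%N -> (size q <= b.+1)%N -> (p * q)`_(a + b) = p`_a * q`_b.
Proof.
move=> szp szq; rewrite coefM.
have lt_a : (a < (a + b).+1)%N by rewrite ltnS leq_addr.
rewrite (bigD1 (Ordinal lt_a)) //= addKn big1 ?addr0 // => i ne_ia.
have {ne_ia} : (i != a :> nat) by [].
case: ltngtP => // [lt_ia | gt_ia] _.
  by rewrite [q`__]nth_default ?mulr0 // (leq_trans szq) //; lia.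
by rewrite [p`__]nth_default ?mul0r // (leq_trans szp).
Qed.

Lemma coef_prod_top (R : comNzRingType) (I : Type) (s : seq I) (F : I -> {poly R}) r :
  (forall i, (size (F i) <= r.+1)%N) ->
  (size (\prod_(i <- s) F i)%R <= (r * size s).+1)%N /\
  (\prod_(i <- s) F i)`_(r * size s) = \prod_(i <- s) (F i)`_r.
Proof.
move=> szF; elim: s => [|i s [IHsz IHc]] /=.
  by rewrite !big_nil muln0 size_poly1 coef1.
rewrite !big_cons mulnS; set P := (\prod_(j <- s) F j)%R in IHsz IHc *; split.
  apply: (leq_trans (size_polyMleq _ _)); rewrite -subn1 leq_subLR.
  by apply: leq_trans (leq_add (szF i) IHsz) _; rewrite addSn addnS add1n.
by rewrite coef_mul_top // IHc.
Qed.

(** Term by term in the Leibniz expansion: the coefficient of degree [r * d] of a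
    product of [d] entries is the product of their coefficients of degree [r]. *)
Lemma det_top (R : comNzRingType) d (M : 'M[{poly R}]_d) r :
  (forall i j, (size (M i j) <= r.+1)%N) ->
  (size (\det M)%R <= (r * d).+1)%N /\ (\det M)`_(r * d) = \det (map_mx (coefp r) M).
Proof.
move=> szM; have szI : size (index_enum 'I_d) = d.
  by rewrite -[RHS](card_ord d) cardE enumT.
have topP (s : {perm 'I_d}) :=
  coef_prod_top (index_enum 'I_d) (fun i => szM i (s i)).
rewrite szI in topP; rewrite /determinant; split.
  apply: (leq_trans (size_sum _ _ _)); apply/bigmax_leqP => s _.
  by case: (odd_perm s); rewrite ?expr0 ?expr1 ?mulN1r ?size_polyN ?mul1r (topP s).1.
rewrite coef_sum; apply: eq_bigr => s _.
rewrite -signr_odd; case: (odd_perm s) => /=;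
  rewrite ?expr0 ?expr1 ?mulN1r ?coefN ?mul1r (topP s).2.
  by congr (- _); apply: eq_bigr => i _; rewrite !mxE.
by apply: eq_bigr => i _; rewrite !mxE.
Qed.

Lemma mx_neq0P (R : nmodType) m n (M : 'M[R]_(m, n)) :
  M != 0 -> exists i j, M i j != 0.
Proof.
move=> M_neq0; apply/'exists_existsP; apply: contraNT M_neq0 => /existsPn M0.
apply/eqP/matrixP=> i j; rewrite mxE.
by have /existsPn/(_ j) := M0 i; rewrite negbK => /eqP.
Qed.

Lemma mx_top_coef (R : nzRingType) m n (M : 'M[{poly R}]_(m, n)) :
  M != 0 -> exists r, (forall i j, (size (M i j) <= r.+1)%N) /\
                      map_mx (coefp r) M != 0.
Proof.
move=> /mx_neq0P[i0 [j0 nz]].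
pose sz (p : 'I_m * 'I_n) := size (M p.1 p.2).
have [[i j] _ max_ij] := @arg_maxnP _ (i0, j0) xpredT sz isT.
have sz_gt0 : (0 < sz (i, j))%N.
  by apply: leq_trans (max_ij (i0, j0) isT); rewrite lt0n size_poly_eq0.
exists (sz (i, j)).-1; rewrite prednK //; split=> [i' j'|]; first exact: (max_ij (i', j')).
apply: contraTneq sz_gt0 => /matrixP/(_ i j)/eqP.
by rewrite !mxE -/(lead_coef _) lead_coef_eq0 => /eqP Mij0; rewrite /sz Mij0 size_poly0.
Qed.

(** * The twisted commutation relation *)

Section Twisted.
Variables (R : idomainType) (sigma : {rmorphism R -> R}) (u : R) (d : nat).
Hypothesis u_neq0 : u != 0.
Implicit Types a b : 'M[R]_d.

(** The matrix of the generator [v] of a cyclic algebra, [v ^ d = u], with [u] in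
    the bottom left corner. *)
Definition cyc : 'M[R]_d :=
  \matrix_(i, j) (u ^+ (i.+1 == d) *+ (j == ordS i)).

(** The fixed ring of [a |-> g^-1 sigma(a) g], written without inverses so that
    it makes sense over a polynomial ring.  Over a field with an automorphism
    [sigma] of order [d] fixing [u], this ring is the cyclic algebra attached to
    [sigma] and [u]. *)
Definition twisted a := cyc *m a = map_mx sigma a *m cyc.

Lemma twistedP a :
  twisted a <-> forall i j : 'I_d,
    u ^+ (i.+1 == d) * a (ordS i) (ordS j) = u ^+ (j.+1 == d) * sigma (a i j).
Proof.
have lE (i j : 'I_d) : (cyc *m a) i j = u ^+ (i.+1 == d) * a (ordS i) j.
  rewrite !mxE (bigD1 (ordS i)) //= big1 ?addr0 ?mxE ?eqxx ?mulr1n // => k ne.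
  by rewrite mxE (negPf ne) mulr0n mul0r.
have rE (i j : 'I_d) : (map_mx sigma a *m cyc) i (ordS j) = u ^+ (j.+1 == d) * sigma (a i j).
  rewrite !mxE (bigD1 j) //= big1 ?addr0 ?mxE ?eqxx ?mulr1n; first by rewrite mulrC.
  move=> k ne; rewrite !mxE (inj_eq (@ordS_inj _)) [j == k]eq_sym (negPf ne) mulr0n.
  by rewrite mulr0.
split=> [tw i j | eq_a]; first by rewrite -lE tw rE.
by apply/matrixP=> i j; rewrite -[j]ord_predK lE rE eq_a.
Qed.

Lemma det_cyc_neq0 : \det cyc != 0.
Proof.
apply: (det_monomial_neq0 (f := @ordS d)); first exact: ordS_inj.
move=> i j; rewrite mxE; case: (j == ordS i) => /=; last by rewrite mulr0n eqxx.
by rewrite mulr1n expf_neq0.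
Qed.

Lemma twistedD a b : twisted a -> twisted b -> twisted (a + b).
Proof. by rewrite /twisted mulmxDr map_mxD mulmxDl => -> ->. Qed.

Lemma twistedB a b : twisted a -> twisted b -> twisted (a - b).
Proof. by rewrite /twisted mulmxBr map_mxB mulmxBl => -> ->. Qed.

Lemma twistedM a b : twisted a -> twisted b -> twisted (a *m b).
Proof. by rewrite /twisted map_mxM mulmxA => ->; rewrite -!mulmxA => ->. Qed.

(** Taking determinants in [g a = sigma(a) g] and cancelling [det g]. *)
Lemma twisted_det a : twisted a -> sigma (\det a) = \det a.
Proof.
move/(congr1 determinant); rewrite !det_mulmx det_map_mx mulrC.
by move/(mulIf det_cyc_neq0).
Qed.

Lemma twistedZ c a : sigma c = c -> twisted a -> twisted (c *: a).
Proof. by move=> sc; rewrite /twisted map_mxZ sc -scalemxAr -scalemxAl => ->. Qed.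

(** The adjugate is determined by [a b = det a], and [det a] is fixed by [sigma];
    both [cyc *m \adj a] and [map_mx sigma (\adj a) *m cyc] solve the same equation
    with the nonsingular coefficient [map_mx sigma a]. *)
Lemma twisted_adj a : twisted a -> \det a != 0 -> twisted (\adj a).
Proof.
move=> tw da_neq0; have sda := twisted_det tw.
have : map_mx sigma a *m (cyc *m \adj a - map_mx sigma (\adj a) *m cyc) = 0.
  rewrite mulmxBr !mulmxA -tw -map_mxM -!mulmxA mul_mx_adj map_scalar_mx /= sda.
  by rewrite scalar_mxC subrr.
move/(congr1 (mulmx (\adj (map_mx sigma a)))).
rewrite mulmxA mul_adj_mx det_map_mx sda mulmx0 mul_scalar_mx => eq0.
apply/eqP; rewrite -subr_eq0; apply/eqP/matrixP=> i j; move/matrixP: eq0 => /(_ i j)/eqP.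
by rewrite [RHS]mxE mxE [X in _ == X]mxE mulf_eq0 (negPf da_neq0) => /eqP.
Qed.

End Twisted.

Lemma val_iter_ordS d n (i : 'I_d) : val (iter n (@ordS d) i) = ((i + n) %% d)%N.
Proof.
elim: n => [|n IHn]; first by rewrite addn0 modn_small.
by rewrite iterS /= IHn -addn1 modnDml addn1 addnS.
Qed.

(** * Nonzero twisted matrices are nonsingular *)

Section Division.
Variables (R : idomainType) (sigma : {rmorphism R -> R}) (d : nat).
Hypothesis sigma_inj : injective sigma.

Lemma val_ordS_last (i : 'I_d) : (ordS i + d * (i.+1 == d) = i.+1)%N.
Proof.
rewrite /=; case: eqP => [->|ne]; first by rewrite modnn muln1.
by rewrite modn_small ?muln0 ?addn0 // ltn_neqAle ltn_ord andbT; apply/eqP.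
Qed.

(** The top [w]-coefficient [C] of the regraded matrix is monomial.  The grading
    modulo [d] confines the entries of [C] to a single cyclic diagonal, and the
    twisted relation makes [sigma] carry each entry of that diagonal to the next,
    so that they vanish together. *)
Lemma twisted_poly_det_neq0 (a : 'M[{poly R}]_d) :
  twisted (map_poly sigma) 'X a -> a != 0 -> \det a != 0.
Proof.
move/(twistedP (map_poly sigma) 'X) => tw a_neq0.
have d_gt0 : (0 < d)%N.
  by case: (d) (a) a_neq0 => // a'; rewrite [a']thinmx0 eqxx.
(* The substitution [u = w^d] and conjugation by [diag (w^i)]; the extra factor
   [w^d] keeps the exponents nonnegative. *)
pose aw : 'M[{poly R}]_d := \matrix_(i, j) ('X^(d + j - i) * (a i j \Po 'X^d)).
have aw_tw i j : aw (ordS i) (ordS j) = map_poly sigma (aw i j).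
  have := congr1 (comp_poly 'X^d) (tw i j); rewrite !comp_polyM !rmorphXn /=.
  rewrite !comp_polyX -!exprM => eq_tw; rewrite !mxE.
  apply: (@mulfI _ ('X^(d * (i.+1 == d)))); first by rewrite expf_neq0 ?polyX_eq0.
  rewrite mulrCA eq_tw mulrA -exprD rmorphM /= map_polyXn map_comp_poly.
  rewrite map_polyXn mulrA -exprD; congr ('X^_ * _).
  move: (val_ordS_last i) (val_ordS_last j) (ltn_ord (ordS i)) (ltn_ord i).
  by move=> /=; move: (d * _)%N (d * _)%N (_ %% d)%N (_ %% d)%N => ? ? ? ?; lia.
(* The exponents of [w] in the entry [(i, j)] are congruent to [j - i] mod [d]. *)
have aw_coef i j n : (aw i j)`_n != 0 -> j = ((i + n) %% d)%N :> nat.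
  rewrite mxE coefXnM coef_comp_poly_Xn //; case: ltnP => [|le_n]; first by rewrite eqxx.
  case: ifP => [/dvdnP[q eq_q] _|_]; last by rewrite eqxx.
  have -> : (i + n = j + q.+1 * d)%N by have := ltn_ord i; rewrite mulSn; lia.
  by rewrite addnC modnMDl modn_small.
have aw_neq0 : aw != 0.
  have [i [j nz]] := mx_neq0P a_neq0.
  apply: contraNneq nz => /matrixP/(_ i j)/eqP; rewrite !mxE mulf_eq0.
  by rewrite expf_eq0 polyX_eq0 andbF comp_poly_eq0 // size_polyXn.
have [r [sz_aw]] := mx_top_coef aw_neq0.
set C := map_mx _ _ => /mx_neq0P[i0 [j0 nz0]].
have C_coef i j : C i j != 0 -> j = ((i + r) %% d)%N :> nat by rewrite mxE; apply: aw_coef.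
have C_tw i j : (C (ordS i) (ordS j) != 0) = (C i j != 0).
  by rewrite mxE aw_tw [C i j]mxE /= coef_map /= raddf_eq0.
have C_iter n i j : (C (iter n (@ordS d) i) (iter n (@ordS d) j) != 0) = (C i j != 0).
  by elim: n => //= n IHn; rewrite C_tw.
have detC : \det C != 0.
  pose f i : 'I_d := iter r (@ordS d) i.
  have f_inj : injective f by rewrite /f => i j; elim: (r) => //= n IHn /ordS_inj/IHn.
  have Cf i j : C i j != 0 -> j = f i.
    by move/C_coef => eq_j; apply: val_inj; rewrite val_iter_ordS.
  apply: (det_monomial_neq0 f_inj) => i j; apply/idP/eqP => [/Cf // | ->].
  have -> : i = iter (i + (d - i0)) (@ordS d) i0.
    apply: val_inj; rewrite val_iter_ordS addnCA subnKC; last exact: ltnW.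
    by rewrite modnDr modn_small.
  set n := (i + (d - i0))%N.
  by rewrite /f -iterD [(r + n)%N]addnC iterD C_iter -/(f i0) -(Cf _ _ nz0).
pose Dl := diag_mx (\row_(i < d) ('X^i : {poly R})).
pose Dr := diag_mx (\row_(j < d) ('X^(d + j) : {poly R})).
have eq_aw : Dl *m aw = map_mx (comp_poly 'X^d) a *m Dr.
  apply/matrixP=> i j; rewrite mul_diag_mx mul_mx_diag !mxE mulrA -exprD mulrC.
  by congr (_ * 'X^_); have := ltn_ord i; lia.
have det_aw : \det aw != 0.
  by apply: contraNneq detC => det0; rewrite -(det_top sz_aw).2 det0 coef0.
apply: contraNneq det_aw => det_a0; have := congr1 determinant eq_aw.
rewrite !det_mulmx det_map_mx det_a0 rmorph0 mul0r => /eqP.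
rewrite mulf_eq0 => /orP[|//]; rewrite det_diag => /prodf_eq0[i _].
by rewrite mxE expf_eq0 polyX_eq0 andbF.
Qed.

(** The relation does not involve the outer variable [t], so the top
    [t]-coefficient is again twisted, hence nonsingular, and its determinant is
    the top coefficient of the determinant. *)
Lemma twisted_poly2_det_size (a : 'M[{poly {poly R}}]_d) :
  twisted (map_poly (map_poly sigma)) ('X)%:P a -> a != 0 ->
  \det a != 0 /\ (d %| (size (\det a)).-1)%N.
Proof.
move/(twistedP (map_poly (map_poly sigma)) 'X%:P) => tw a_neq0.
have [r [sz_a top_a]] := mx_top_coef a_neq0.
have [sz_det top_det] := det_top sz_a.
have top_neq0 : (\det a)`_(r * d) != 0.
  rewrite top_det; apply: twisted_poly_det_neq0 => //.
  apply/twistedP => i j; rewrite !mxE /=.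
  have := congr1 (coefp (r : nat)) (tw i j).
  by rewrite /= -!rmorphXn /= !coefCM coef_map.
have szE : size (\det a) = (r * d).+1.
  by apply/eqP; rewrite eqn_leq sz_det ltnNge; apply: contra top_neq0 => /leq_sizeP->.
by rewrite szE dvdn_mull // -size_poly_eq0 szE.
Qed.
End Division.

(** * Block elimination *)

Section Elimination.
Variable d : nat.

Definition bindex l (p : 'I_l) (i : 'I_d) : 'I_(l * d) := mxtens_index (p, i).

(** The layout is that of the Kronecker product, so that the blocks of a blow-up
    are combinations of the generic matrices [X_k]. *)
Definition block (T : Type) l (M : 'M[T]_(l * d)) (p q : 'I_l) : 'M[T]_d :=
  mxsub (bindex p) (bindex q) M.

Lemma bindex0 l i : bindex (@ord0 l) i = lshift (l * d) i.
Proof. exact: val_inj. Qed.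

Lemma bindexS l (p : 'I_l) i : bindex (lift ord0 p) i = rshift d (bindex p i).
Proof. by apply: val_inj; rewrite /= /bump /= mulSn addnA. Qed.

Variable (R : idomainType) (S : 'M[{poly R}]_d -> Prop).
Hypothesis S_add : forall a b, S a -> S b -> S (a + b).
Hypothesis S_schur : forall a b c e, S a -> S b -> S c -> S e -> a != 0 ->
  S (\det a *: e - c *m \adj a *m b).
Hypothesis S_deg : forall a, S a -> a != 0 ->
  \det a != 0 /\ (d %| (size (\det a)).-1)%N.

Lemma dvd_deg_mul (p q : {poly R}) : p != 0 -> q != 0 ->
  (d %| (size p).-1)%N -> (d %| (size (p * q)%R).-1)%N = (d %| (size q).-1)%N.
Proof.
move=> p0 q0 dvd_p; rewrite size_mul //.
move: p0 q0; rewrite -!size_poly_gt0 => p0 q0.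
by rewrite -(prednK p0) -(prednK q0) addSn addnS /= dvdn_addr.
Qed.

Lemma dvd_deg_exp (p : {poly R}) n : p != 0 ->
  (d %| (size p).-1)%N -> (d %| (size (p ^+ n)%R).-1)%N.
Proof.
move=> p0 dvd_p; elim: n => [|n IHn]; first by rewrite expr0 size_poly1.
by rewrite exprS dvd_deg_mul // expf_neq0.
Qed.

(** With pivot block [a], the left factor clears the first block column at the
    price of [det a ^ (l * d)], whose degree is a multiple of [d]; what remains is
    [det a] times the determinant of the smaller matrix of Schur complements. *)
Lemma dvd_deg_det_pivot l (M : 'M[{poly R}]_(l.+1 * d)) :
    (forall M' : 'M_(l * d), (forall p q, S (block M' p q)) -> \det M' != 0 ->
       (d %| (size (\det M')).-1)%N) ->
    (forall p q, S (block M p q)) -> block M ord0 ord0 != 0 -> \det M != 0 ->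
  (d %| (size (\det M)).-1)%N.
Proof.
move=> IHl SM; pose N : 'M_(d + l * d) := M; rewrite -[M]/N.
pose a := ulsubmx N; pose b := ursubmx N; pose c := dlsubmx N; pose e := drsubmx N.
have -> : block M ord0 ord0 = a.
  by apply/matrixP=> i j; rewrite !mxE !bindex0.
move=> a_neq0 detN.
have Sa : S a.
  by have := SM ord0 ord0; congr S; apply/matrixP=> i j; rewrite !mxE !bindex0.
have [det_a dvd_a] := S_deg Sa a_neq0.
pose e' := \det a *: e - c *m \adj a *m b.
have eqN : block_mx 1%:M 0 (- (c *m \adj a)) (\det a)%:M *m N = block_mx a b 0 e'.
  rewrite -[N in LHS]submxK mulmx_block !mul1mx !mul0mx !addr0 !mulNmx -mulmxA.
  by rewrite mul_adj_mx mul_mx_scalar !mul_scalar_mx addNr addrC.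
have := congr1 determinant eqN.
rewrite det_mulmx det_lblock det1 mul1r det_scalar det_ublock => eq_det.
have det_e' : \det e' != 0.
  by have := mulf_neq0 (expf_neq0 (l * d) det_a) detN; rewrite eq_det mulf_eq0; case/norP.
rewrite -(dvd_deg_mul _ detN (dvd_deg_exp (l * d) det_a dvd_a)) ?expf_neq0 //.
rewrite eq_det dvd_deg_mul //; apply: IHl => // p q.
have -> : block e' p q = \det a *: block M (lift ord0 p) (lift ord0 q)
    - block M (lift ord0 p) ord0 *m \adj a *m block M ord0 (lift ord0 q).
  rewrite /block linearB linearZ /= mxsub_mul -mul_rowsub_mx.
  have -> : mxsub (bindex p) (bindex q) e = block M (lift ord0 p) (lift ord0 q).
    by apply/matrixP=> i j; rewrite !mxE !bindexS.
  have -> : rowsub (bindex p) c = block M (lift ord0 p) ord0.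
    by apply/matrixP=> i j; rewrite !mxE bindexS bindex0.
  have -> // : colsub (bindex q) b = block M ord0 (lift ord0 q).
  by apply/matrixP=> i j; rewrite !mxE bindexS bindex0.
exact: S_schur.
Qed.

(** If the corner block vanishes, adding to the first block row a block row that is
    nonzero in the first block column produces a pivot without changing the
    determinant. *)
Lemma dvd_deg_det l (M : 'M[{poly R}]_(l * d)) :
  (0 < d)%N -> (forall p q, S (block M p q)) -> \det M != 0 ->
  (d %| (size (\det M)).-1)%N.
Proof.
move=> d_gt0; elim: l M => [|l IHl] M SM detM.
  by rewrite [M]flatmx0 det_mx00 size_poly1.
have [M00|] := eqVneq (block M ord0 ord0) 0; last by move/dvd_deg_det_pivot; apply.
have [p nz_p] : exists p, block M p ord0 != 0.
  apply/existsP; apply: contraNT detM => /existsPn M0.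
  rewrite (expand_det_col _ (bindex ord0 (Ordinal d_gt0))) big1 // => k _.
  have [p i] := mxtens_indexP k; have := M0 p; rewrite negbK => /eqP/matrixP.
  by move/(_ i (Ordinal d_gt0)); rewrite !mxE => ->; rewrite mul0r.
have [p0 | [p' eq_p]] : p = ord0 \/ exists p', p = lift ord0 p'.
- by case: (unliftP ord0 p) => [p' ->|->]; [right; exists p' | left].
- by rewrite p0 M00 eqxx in nz_p.
pose Y : 'M[{poly R}]_(d, l * d) := \matrix_(i, k) (k == bindex p' i)%:R.
pose E : 'M[{poly R}]_(d + l * d) := block_mx 1%:M Y 0 1%:M.
pose N : 'M_(l.+1 * d) := E *m (M : 'M_(d + l * d)).
have detN : \det N = \det M.
  by rewrite [LHS]det_mulmx det_ublock !det1 !mul1r.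
have N0 q : block N ord0 q = block M ord0 q + block M p q.
  apply/matrixP=> i j; rewrite !mxE bindex0 eq_p bindexS.
  have Ei k : E (lshift _ i) k = row_mx 1%:M Y i k by rewrite -[E]/(col_mx _ _) col_mxEu.
  transitivity ((row_mx 1%:M Y *m (M : 'M_(d + l * d))) i (bindex q j)).
    by rewrite !mxE; apply: eq_bigr => k _; rewrite Ei.
  rewrite -[M in LHS](vsubmxK (M : 'M_(d + l * d))) mul_row_col mul1mx !mxE; congr (_ + _).
  rewrite (bigD1 (bindex p' i)) //= big1 ?addr0 => [|k ne]; rewrite !mxE ?eqxx ?mul1r //.
  by rewrite (negPf ne) mul0r.
have NS r q : block N (lift ord0 r) q = block M (lift ord0 r) q.
  apply/matrixP=> i j; rewrite !mxE bindexS.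
  have Ei k : E (rshift _ (bindex r i)) k = row_mx 0 1%:M (bindex r i) k.
    by rewrite -[E]/(col_mx _ _) col_mxEd.
  transitivity ((row_mx 0 1%:M *m (M : 'M_(d + l * d))) (bindex r i) (bindex q j)).
    by rewrite !mxE; apply: eq_bigr => k _; rewrite Ei.
  by rewrite -[M in LHS](vsubmxK (M : 'M_(d + l * d))) mul_row_col mul1mx mul0mx add0r !mxE.
rewrite -detN; apply: dvd_deg_det_pivot => //; last by rewrite detN.
- by move=> r q; case: (unliftP ord0 r) => [r' ->|->]; rewrite ?NS // N0; apply: S_add.
- by rewrite N0 M00 add0r.
Qed.
End Elimination.

(** * The blow-up over a cyclic division algebra *)

(** The degree in the entries of [X_k]; [proj] is this degree divided by [d]. *)
Definition kdeg m d (z : 'X_{1..nvars m d}) (k : 'I_m) : nat :=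
  (\sum_(i < d) \sum_(j < d) z (xvar k i j))%N.

Lemma big_nvars (T : Type) (idx : T) (op : Monoid.com_law idx) m d
    (F : 'I_(nvars m d) -> T) :
  \big[op/idx]_v F v =
  \big[op/idx]_(k < m) \big[op/idx]_(i < d) \big[op/idx]_(j < d) F (xvar k i j).
Proof.
rewrite (reindex (fun p : 'I_m * 'I_d * 'I_d => enum_rank p)) /=; last first.
  by apply: onW_bij; apply: enum_rank_bij.
rewrite pair_bigA /= pair_bigA /=.
by apply: eq_bigr => -[[k i] j] _.
Qed.

Lemma map_poly2C (R : nzRingType) (f : {rmorphism R -> R}) x :
  map_poly (map_poly f) x%:P%:P = (f x)%:P%:P.
Proof. by rewrite map_polyC /= map_polyC. Qed.

Lemma map_poly2_monomial (R : nzRingType) (f : {rmorphism R -> R}) x a b :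
  map_poly (map_poly f) ((x *: 'X^a) *: 'X^b) = (f x *: 'X^a) *: 'X^b.
Proof. by rewrite map_polyZ map_polyXn /= map_polyZ map_polyXn. Qed.

Section Generic.
Variables (K : fieldType) (m d : nat).
Let R0 := {mpoly K[nvars m d]}.

(** The permutation of the variables that induces [sigma]: both indices of each
    [X_k] move cyclically. *)
Definition shift_var (v : 'I_(nvars m d)) : 'I_(nvars m d) :=
  let: (k, i, j) := enum_val v in xvar k (ordS i) (ordS j).

Lemma shift_varE k i j : shift_var (xvar k i j) = xvar k (ordS i) (ordS j).
Proof. by rewrite /shift_var enum_rankK. Qed.

Lemma shift_var_inj : injective shift_var.
Proof.
move=> v w; rewrite -[v]enum_valK -[w]enum_valK.
case: (enum_val v) (enum_val w) => [[k i] j] [[k' i'] j'].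
rewrite !shift_varE => /enum_rank_inj/eqP; rewrite !xpair_eqE !(inj_eq (@ordS_inj _)).
by case/andP=> /andP[/eqP-> /eqP->] /eqP->.
Qed.

Definition shift : {rmorphism R0 -> R0} := msym (perm shift_var_inj).

Lemma shiftX k i j : shift 'X_(xvar k i j) = 'X_(xvar k (ordS i) (ordS j)).
Proof. by rewrite /= /msym mmapX mmap1U permE shift_varE. Qed.

Lemma shiftC (a : K) : shift a%:MP = a%:MP.
Proof. by rewrite /= /msym mmapC. Qed.

Lemma shift_inj : injective shift.
Proof. exact: inj_msym. Qed.

Variable c : 'I_m -> nat.

Definition weight (z : 'X_{1..nvars m d}) : nat := (\sum_(k < m) c k * kdeg z k)%N.

Definition uexp (z : 'X_{1..nvars m d}) : nat :=
  (\sum_(k < m) \sum_(i < d) \sum_(j < d) (j < i) * z (xvar k i j))%N.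

Definition mark_coef (a : K) : {poly {poly R0}} := (a%:MP)%:P%:P.

(** The inner variable is [u] and the outer one is [t].  The factor [u] below the
    diagonal turns the generic matrix [X_k] into a twisted one. *)
Definition mark_var (v : 'I_(nvars m d)) : {poly {poly R0}} :=
  let: (k, i, j) := enum_val v in ('X_v *: 'X^(j < i)) *: 'X^(c k).

HB.instance Definition _ :=
  GRing.RMorphism.copy mark_coef (polyC \o polyC \o @mpolyC (nvars m d) K).

Definition mark : {rmorphism R0 -> {poly {poly R0}}} := mmap mark_coef mark_var.

Lemma mark_varE k i j :
  mark_var (xvar k i j) = ('X_(xvar k i j) *: 'X^(j < i)) *: 'X^(c k).
Proof. by rewrite /mark_var enum_rankK. Qed.

Lemma mark_monomial z : mmap1 mark_var z = ('X_[z] *: 'X^(uexp z)) *: 'X^(weight z).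
Proof.
rewrite /mmap1 big_nvars mpolyXE_id big_nvars.
rewrite /weight /uexp /kdeg -!mul_polyC.
under [X in _ = _ * 'X^X]eq_bigr do rewrite big_distrr /=.
under [X in _ = _ * 'X^X]eq_bigr do under eq_bigr do rewrite big_distrr /=.
rewrite !expr_sum !rmorphM !rmorph_prod /= -!big_split /=; apply: eq_bigr => k _.
rewrite !expr_sum !rmorph_prod /= -!big_split /=; apply: eq_bigr => i _.
rewrite !expr_sum !rmorph_prod /= -!big_split /=; apply: eq_bigr => j _.
by rewrite mark_varE -!mul_polyC rmorphM !exprMn -!rmorphXn /= -!exprM.
Qed.

Lemma coef_mark p n :
  (mark p)`_n = \sum_(z <- msupp p | weight z == n) (p@_z *: 'X_[z]) *: 'X^(uexp z).
Proof.
rewrite /= /mmap coef_sum [RHS]big_mkcond; apply: eq_bigr => z _.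
rewrite mark_monomial /mark_coef coefCM coefZ coefXn eq_sym; case: eqP => _.
  by rewrite mulr1 mul_polyC scalerA mul_mpolyC.
by rewrite !mulr0.
Qed.

(** Distinct monomials keep distinct images, so nothing cancels at top weight;
    this is read off after setting [u = 1]. *)
Lemma size_mark p z0 : z0 \in msupp p ->
  {in msupp p, forall z, weight z <= weight z0}%N -> size (mark p) = (weight z0).+1.
Proof.
move=> z0p max_z0; apply/eqP; rewrite eqn_leq; apply/andP; split.
  apply/leq_sizeP => n lt_n; rewrite coef_mark big_seq_cond big1 // => z.
  by case/andP=> /max_z0 le_z /eqP eq_n; move: lt_n; rewrite -eq_n ltnNge le_z.
rewrite ltnNge; apply/negP => /leq_sizeP/(_ _ (leqnn _)).
rewrite coef_mark => /(congr1 (fun q => (q.[1])@_z0)).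
rewrite horner_sum raddf_sum horner0 mcoeff0 /=.
rewrite -big_filter (bigD1_seq z0) ?filter_uniq ?msupp_uniq ?mem_filter ?eqxx //=.
rewrite big1 => [|z ne]; rewrite hornerZ hornerXn expr1n mulr1 mcoeffZ mcoeffX.
  by rewrite eqxx mulr1 addr0 => /eqP; rewrite mcoeff_eq0 z0p.
by rewrite (negPf ne) mulr0.
Qed.

Lemma shift_mark_coef a : map_poly (map_poly shift) (mark_coef a) = mark_coef a.
Proof. by rewrite /mark_coef map_poly2C shiftC. Qed.

Lemma shift_mark_var k i j : map_poly (map_poly shift) (mark_var (xvar k i j)) =
  ('X_(xvar k (ordS i) (ordS j)) *: 'X^(j < i)) *: 'X^(c k).
Proof. by rewrite mark_varE map_poly2_monomial shiftX. Qed.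

(** The scalars are fixed by the shift, and for [X_k] the relation compares the
    exponents of [u]: passing from [(i, j)] to the shifted position changes
    [j < i] exactly when only one of the two indices wraps around. *)
Lemma twisted_mark_blowup l (B : 'I_m -> 'M[K]_l) p q :
  twisted (map_poly (map_poly shift)) 'X%:P (block (map_mx mark (blowup d B)) p q).
Proof.
apply/twistedP => i j.
have eqM i' j' : block (map_mx mark (blowup d B)) p q i' j' =
    \sum_k mark_coef (B k p q) * mark_var (xvar k i' j').
  rewrite !mxE /blowup summxE rmorph_sum; apply: eq_bigr => k _.
  by rewrite tensmxE !mxE rmorphM /= mmapC mmapX mmap1U.
have eqS : map_poly (map_poly shift) (block (map_mx mark (blowup d B)) p q i j) =
    \sum_k mark_coef (B k p q) *
      (('X_(xvar k (ordS i) (ordS j)) *: 'X^(j < i)) *: 'X^(c k)).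
  rewrite eqM; apply: (etrans (rmorph_sum _ _ _ _)); apply: eq_bigr => k _.
  apply: (etrans (rmorphM _ _ _)).
  by congr (_ * _); [apply: shift_mark_coef | apply: shift_mark_var].
apply: (etrans _ (congr1 (fun x => _ * x) (esym eqS))).
rewrite eqM !mulr_sumr; apply: eq_bigr => k _; rewrite mark_varE mulrCA [RHS]mulrCA.
congr (_ * _); rewrite -!rmorphXn !mul_polyC !scalerA -!scalerAr -!exprD.
congr ((_ *: 'X^_) *: _).
have := val_ordS_last i; have := val_ordS_last j; move: (ltn_ord i) (ltn_ord j).
by do 2 case: eqP => ? /=; rewrite ?muln1 ?muln0; lia.
Qed.
End Generic.

(** The form of the regularity lemma for blow-ups that is used here: the weighted
    degree of the determinant is [d] times a degree over a division ring. *)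
Lemma dvd_max_weight (K : fieldType) m d l (B : 'I_m -> 'M[K]_l) (c : 'I_m -> nat) z0 :
  (0 < d)%N -> z0 \in msupp (\det (blowup d B)) ->
  {in msupp (\det (blowup d B)), forall z, weight c z <= weight c z0}%N ->
  (d %| weight c z0)%N.
Proof.
move=> d_gt0 z0_supp z0_max.
pose tw (a : 'M_d) := twisted (map_poly (map_poly (@shift K m d))) 'X%:P a.
have u_neq0 : 'X%:P != 0 :> {poly {poly {mpoly K[nvars m d]}}}.
  by rewrite polyC_eq0 polyX_eq0.
have tw_deg a : tw a -> a != 0 -> \det a != 0 /\ (d %| (size (\det a)).-1)%N.
  by apply: twisted_poly2_det_size; apply: shift_inj.
have tw_schur a b e f : tw a -> tw b -> tw e -> tw f -> a != 0 ->
    tw (\det a *: f - e *m \adj a *m b).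
  move=> twa twb twe twf /(tw_deg _ twa)[det_a _].
  apply: twistedB; first exact: twistedZ (twisted_det u_neq0 twa) twf.
  exact: twistedM (twistedM twe (twisted_adj u_neq0 twa det_a)) twb.
have sz_mark := size_mark z0_supp z0_max.
rewrite -[weight c z0]/((weight c z0).+1.-1) -sz_mark -det_map_mx.
apply: (dvd_deg_det (@twistedD _ _ _ _) tw_schur tw_deg d_gt0).
  exact: twisted_mark_blowup.
by rewrite det_map_mx -size_poly_eq0 sz_mark.
Qed.

(** * Exposing the extreme points of a finitely generated hull *)

Section Gordan.
Variables (R : realFieldType) (m : nat).

Definition dot (c q : 'rV[R]_m) : R := \sum_k c 0 k * q 0 k.

Lemma dotDl c e q : dot (c + e) q = dot c q + dot e q.
Proof. by rewrite -big_split; apply: eq_bigr => k _; rewrite mxE mulrDl. Qed.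

Lemma dotZl x c q : dot (x *: c) q = x * dot c q.
Proof. by rewrite /dot mulr_sumr; apply: eq_bigr => k _; rewrite mxE mulrA. Qed.

Lemma dotC c q : dot c q = dot q c.
Proof. by apply: eq_bigr => k _; rewrite mulrC. Qed.

Lemma dot_gt0 q : q != 0 -> 0 < dot q q.
Proof.
move=> /mx_neq0P[i [k]]; rewrite [i]ord1 => qk.
rewrite /dot (bigD1 k) //= ltr_wpDr ?sumr_ge0 // => [j _|]; rewrite -expr2 ?sqr_ge0 //.
by rewrite lt0r sqr_ge0 sqrf_eq0 qk.
Qed.

Lemma small_perturbation r (a b : 'I_r -> R) : (forall i, a i < 0) ->
  exists2 e, 0 < e & forall i, a i + e * b i < 0.
Proof.
move=> a_lt0; pose N := 1 + \sum_i `|b i| / - a i.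
have term_ge0 i : 0 <= `|b i| / - a i by rewrite divr_ge0 // oppr_ge0 ltW.
have N_gt0 : 0 < N by rewrite ltr_wpDr ?sumr_ge0.
exists N^-1 => [|i]; first by rewrite invr_gt0.
rewrite -(pmulr_rlt0 _ N_gt0) mulrDr mulrA divff ?gt_eqF // mul1r addrC -ltrBrDr sub0r.
have le_N : 1 + `|b i| / - a i <= N.
  by rewrite lerD2l (bigD1 i) //= lerDl sumr_ge0.
have na_gt0 : 0 < - a i by rewrite oppr_gt0.
rewrite -mulrN; apply: (lt_le_trans _ (ler_wpM2r (ltW na_gt0) le_N)).
rewrite mulrDl mul1r divfK ?gt_eqF //.
by rewrite (le_lt_trans (ler_norm _)) // ltrDr.
Qed.

(** Gordan's alternative, by induction on the number of vectors.  If the form [c]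
    obtained for all vectors but [q0] is positive on [q0], the other vectors are
    moved along [q0] into the kernel of [c]; a form negative on the moved vectors,
    corrected by a multiple of [c] to vanish on [q0], is negative on the original
    ones.  A small multiple of [q0] is then subtracted to make it negative on [q0]
    too. *)
Lemma gordan r (q : 'I_r -> 'rV[R]_m) :
  (forall w : 'I_r -> R, (forall i, 0 <= w i) -> \sum_i w i *: q i = 0 ->
     forall i, w i = 0) ->
  exists c, forall i, dot c (q i) < 0.
Proof.
elim: r q => [|r IHr] q indep; first by exists 0; case.
pose q0 := q ord0; pose q' i := q (lift ord0 i).
have q0_neq0 : q0 != 0.
  apply/eqP => q0_eq0; have /indep : forall i : 'I_r.+1, 0 <= (i == ord0)%:R :> R by [].
  rewrite big_ord_recl scale1r -/q0 q0_eq0 add0r big1 => [|i _]; last by rewrite scale0r.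
  by move=> /(_ erefl ord0)/eqP; rewrite eqxx oner_eq0.
have indep' w0 (w : 'I_r -> R) : 0 <= w0 -> (forall i, 0 <= w i) ->
    w0 *: q0 + \sum_i w i *: q' i = 0 -> forall i, w i = 0.
  move=> w0_ge0 w_ge0 rel i; pose w' i := oapp w w0 (unlift ord0 i).
  have w'S j : w' (lift ord0 j) = w j by rewrite /w' liftK.
  rewrite -w'S; apply: indep => [j|]; first by rewrite /w'; case: unliftP => /=.
  by rewrite big_ord_recl {1}/w' unlift_none -[RHS]rel; under eq_bigr do rewrite w'S.
have [e e_q0 e_q'] : exists2 e, dot e q0 <= 0 & forall i, dot e (q' i) < 0.
  have [w w_ge0 rel|c c_q'] := IHr q'.
    by apply: (indep' 0) => //; rewrite scale0r add0r.
  have [c_q0|c_q0] := lerP (dot c q0) 0; first by exists c.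
  pose al i := - dot c (q' i) / dot c q0.
  have al_ge0 i : 0 <= al i by rewrite divr_ge0 ?oppr_ge0 // ltW.
  have [w w_ge0 rel|c' c'_p] := IHr (fun i => q' i + al i *: q0).
    apply: (indep' (\sum_j w j * al j)) => //.
      by rewrite sumr_ge0 // => k _; rewrite mulr_ge0.
    rewrite -[RHS]rel scaler_suml -big_split; apply: eq_bigr => i _.
    by rewrite scalerDr scalerA addrC.
  exists (c' + (- (dot c' q0 / dot c q0)) *: c) => [|i]; rewrite dotDl dotZl.
    by rewrite mulNr divfK ?subrr // gt_eqF.
  apply: le_lt_trans (c'_p i); rewrite [X in _ <= X]dotC dotDl dotZl ![dot _ c']dotC.
  rewrite lerD2l /al le_eqVlt; apply/orP; left; apply/eqP; field.
  by rewrite gt_eqF.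
have [x x_gt0 small] := small_perturbation (fun i => - dot q0 (q' i)) e_q'.
exists (e + (- x) *: q0) => i; rewrite dotDl dotZl.
case: (unliftP ord0 i) => [j ->|->]; first by rewrite mulNr -mulrN; apply: small.
by rewrite mulNr subr_lt0 (le_lt_trans e_q0) // mulr_gt0 // dot_gt0.
Qed.

End Gordan.

Section Extreme.
Local Open Scope classical_set_scope.
Variables (R : realType) (m : nat).
Implicit Types (S : set 'rV[R]_m) (v : 'rV[R]_m).

Lemma sub_Conv S v : S v -> Conv S v.
Proof.
move=> Sv; exists 1%N, (fun=> 1), (fun=> v).
by split=> //; rewrite !big_ord1 ?scale1r.
Qed.

(** Otherwise [v] would lie strictly between [p i] and the normalized combination
    of the remaining points. *)
Lemma extreme_combination S v r (w : 'I_r -> R) (p : 'I_r -> 'rV[R]_m) :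
    extreme_point (Conv S) v -> (forall i, 0 <= w i) -> \sum_i w i = 1 ->
    (forall i, S (p i)) -> v = \sum_i w i *: p i ->
  forall i, 0 < w i -> p i = v.
Proof.
move=> [_ v_ext] w_ge0 w1 Sp v_eq i wi_gt0.
have w1' : w i + \sum_(j < r | j != i) w j = 1 by rewrite -w1 [RHS](bigD1 i).
have wi_le1 : w i <= 1 by rewrite -w1' lerDl sumr_ge0.
have v_eq' : v = w i *: p i + \sum_(j < r | j != i) w j *: p j.
  by rewrite [LHS]v_eq (bigD1 i).
have [wi1|wi_neq1] := eqVneq (w i) 1.
  rewrite v_eq' wi1 scale1r big1 ?addr0 // => j ne_ji.
  have : \sum_(j < r | j != i) w j = 0 by apply: (@addrI _ 1); rewrite -{1}wi1 w1' addr0.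
  move/eqP; rewrite psumr_eq0 // => /allP/(_ j); rewrite mem_index_enum ne_ji.
  by move=> /(_ isT)/eqP->; rewrite scale0r.
have wi_lt1 : w i < 1 by rewrite lt_neqAle wi_neq1.
have w_c : 1 - w i != 0 by rewrite subr_eq0 eq_sym.
pose y := \sum_(j < r | j != i) (w j / (1 - w i)) *: p j.
have Sy : Conv S y.
  exists r, (fun j => if j != i then w j / (1 - w i) else 0), p; split=> // [j||].
  - by case: ifP => // _; rewrite divr_ge0 // subr_ge0.
  - rewrite -big_mkcond -mulr_suml /=.
    by rewrite -(addrK (w i) (\sum_(j < r | _) _)) [_ + w i]addrC w1' divff.
  - rewrite /y big_mkcond; apply: eq_bigr => j _.
    by case: ifP => // _; rewrite scale0r.
have [] // := v_ext (p i) y (w i) (sub_Conv (Sp i)) Sy; first by rewrite wi_gt0.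
rewrite v_eq' /y scaler_sumr; congr (_ + _); apply: eq_bigr => j _.
by rewrite scalerA mulrCA divff ?mulr1.
Qed.

Lemma extreme_mem S v : extreme_point (Conv S) v -> S v.
Proof.
move=> v_ext; have [[r [w [p [w_ge0 w1 Sp v_eq]]]] _] := v_ext.
have /existsP[i wi] : [exists i, w i != 0].
  rewrite -negb_forall; apply/negP => /forallP w0; move/eqP: w1.
  by rewrite big1 1?eq_sym ?oner_eq0 // => i _; apply/eqP/w0.
by rewrite -(extreme_combination v_ext w_ge0 w1 Sp v_eq (i := i)) // lt0r wi w_ge0.
Qed.

(** A nontrivial nonnegative relation between the vectors [p - v] would write [v]
    as a convex combination of points different from [v]; Gordan's alternative
    then provides the form. *)
Lemma extreme_exposed (s : seq 'rV[R]_m) v :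
  extreme_point (Conv [set` s]) v ->
  exists c, forall p, p \in s -> p != v -> dot c p < dot c v.
Proof.
move=> v_ext; pose s' := [seq p <- s | p != v].
pose p (i : 'I_(size s')) := tnth (in_tuple s') i.
have p_s i : p i \in s /\ p i != v.
  by have := mem_tnth i (in_tuple s'); rewrite mem_filter => /andP[].
have [w w_ge0 rel|c c_p] := gordan (q := fun i => p i - v).
  pose W := \sum_i w i.
  have W_ge0 : 0 <= W by rewrite sumr_ge0.
  have [W0|W_neq0] := eqVneq W 0.
    by move=> i; move/eqP: W0; rewrite psumr_eq0 // => /allP/(_ i)/(_ (mem_index_enum _))/eqP.
  have W_gt0 : 0 < W by rewrite lt0r W_neq0.
  have v_eq : v = \sum_i (w i / W) *: p i.
    apply: (scalerI W_neq0); rewrite scaler_sumr.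
    transitivity (\sum_i w i *: p i); last first.
      by apply: eq_bigr => i _; rewrite scalerA mulrCA divff ?mulr1.
    apply/esym/eqP; rewrite -subr_eq0 -[X in _ == X]rel scaler_suml -sumrB.
    by apply/eqP/eq_bigr => i _; rewrite scalerBr.
  move=> i; apply/eqP; rewrite -[_ == 0]negbK; apply/negP => wi.
  have [_] := p_s i; rewrite (extreme_combination v_ext _ _ _ v_eq (i := i)) ?eqxx //.
  - by move=> j; rewrite divr_ge0.
  - by rewrite -mulr_suml divff.
  - by move=> j; case: (p_s j).
  - by rewrite divr_gt0 // lt0r wi w_ge0.
exists c => x xs ne_xv.
have xs' : x \in s' by rewrite mem_filter ne_xv.
have /tnthP[i x_eq] : x \in in_tuple s' by [].
have := c_p i; rewrite /p -x_eq dotC -scaleN1r dotDl dotZl mulN1r subr_lt0.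
by rewrite ![dot _ c]dotC.
Qed.
End Extreme.

(** * Integral exposing weights and integrality *)

(** Constancy of the coordinate sums allows adding a constant to [c] to make it
    nonnegative.  Rounding down the multiple by [N] changes each value by at most
    [D], so that a scaled gap of [2 * D] leaves the margin [D]. *)
Lemma nat_exposing (R : realType) m (T : eqType) (s : seq T) (w : T -> 'I_m -> nat) t0
    (D : nat) (c : 'I_m -> R) :
  (forall t, t \in s -> \sum_k w t k = D)%N -> (\sum_k w t0 k = D)%N ->
  (forall t, t \in s -> w t =1 w t0 \/
     \sum_k c k * (w t k)%:R < \sum_k c k * (w t0 k)%:R) ->
  exists C : 'I_m -> nat, forall t, t \in s -> w t =1 w t0 \/
     (\sum_k C k * w t k + D <= \sum_k C k * w t0 k)%N.
Proof.
move=> sumD sumD0 exposed.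
pose cw t : R := \sum_k c k * (w t k)%:R.
pose M := \sum_k `|c k|; pose c' k := c k + M.
have c'_ge0 k : 0 <= c' k.
  rewrite /c' /M (bigD1 k) //= addrA addr_ge0 ?sumr_ge0 //.
  by have := ler_norm (- c k); rewrite normrN -subr_ge0 opprK addrC.
have c'w t : \sum_k w t k = D -> \sum_k c' k * (w t k)%:R = cw t + M * D%:R :> R.
  by move=> <-; rewrite natr_sum mulr_sumr -big_split; apply: eq_bigr => k _; rewrite mulrDl.
pose ts := tnth (in_tuple s).
pose neg_gap i := if cw (ts i) < cw t0 then cw (ts i) - cw t0 else -1.
have neg_gap_lt0 i : neg_gap i < 0.
  by rewrite /neg_gap; case: ifP; rewrite ?subr_lt0 ?ltrN10.
have [x x_gt0 small] := small_perturbation (fun=> (2 * D)%:R) neg_gap_lt0.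
pose N := Num.bound x^-1; pose C k := Num.truncn (N%:R * c' k).
have N_gt : x^-1 < N%:R by rewrite archi_boundP // invr_ge0 ltW.
exists C => t ts_t.
have [eq_w|lt_w] := exposed t ts_t; [by left | right].
rewrite -/(cw t) -/(cw t0) in lt_w.
have gap : (2 * D)%:R <= N%:R * (cw t0 - cw t).
  have /tnthP[i t_eq] : t \in in_tuple s by [].
  have := small i; rewrite /neg_gap /ts -t_eq lt_w => gap_x.
  have lt_gap : x * (2 * D)%:R < cw t0 - cw t by lra.
  rewrite -(ler_pM2l x_gt0) (le_trans (ltW lt_gap)) // mulrA.
  rewrite ler_peMl ?subr_ge0 ?(ltW lt_w) // ltW //.
  by rewrite -ltr_pdivrMl // mulr1.
have C_le t' : (\sum_k C k * w t' k)%:R <= N%:R * \sum_k c' k * (w t' k)%:R :> R.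
  rewrite natr_sum mulr_sumr ler_sum // => k _; rewrite natrM mulrA ler_wpM2r //.
  by rewrite truncn_le mulr_ge0.
have C_gt t' : N%:R * \sum_k c' k * (w t' k)%:R <= (\sum_k C k * w t' k + \sum_k w t' k)%:R :> R.
  rewrite -big_split natr_sum mulr_sumr ler_sum // => k _ /=.
  rewrite -mulSnr natrM mulrA ler_wpM2r //.
  by rewrite ltW // truncnS_gt.
rewrite -(ler_nat R) natrD.
have := C_gt t0; rewrite c'w // sumD0 natrD.
have := C_le t; rewrite c'w ?sumD //.
by rewrite natrM in gap; lra.
Qed.

Lemma kdeg_total (K : fieldType) m d l (B : 'I_m -> 'M[K]_l) z :
  z \in msupp (\det (blowup d B)) -> (\sum_k kdeg z k = l * d)%N.
Proof.
move=> z_supp; have -> : (\sum_k kdeg z k = mdeg z)%N by rewrite mdegE big_nvars.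
suff /dhomogP/(_ z z_supp) : \det (blowup d B) \is (l * d).-homog for mdeg by [].
have entry i j : blowup d B i j \is 1.-homog for mdeg.
  rewrite /blowup summxE rpred_sum // => k _.
  have [p i'] := mxtens_indexP i; have [q j'] := mxtens_indexP j.
  by rewrite tensmxE !mxE mul_mpolyC dhomogZ // dhomogX /= mdeg1.
rewrite /determinant rpred_sum // => s _.
have : \prod_i blowup d B i (s i) \is (\sum_(i < l * d) 1).-homog for mdeg.
  elim/big_ind2: _ => [|p n q n' hp hq|i _]; [exact: dhomog1 | exact: dhomogM | exact: entry].
rewrite sum1_card card_ord => h.
by case: (odd_perm s); rewrite ?expr0 ?expr1 ?mulN1r ?mul1r ?dhomogN // rpredN.
Qed.

Section Integrality.
Local Open Scope classical_set_scope.
Variables (R : realType) (K : fieldType) (m : nat).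

Lemma projE d (z : 'X_{1..nvars m d}) k : proj R z 0 k = d%:R^-1 * (kdeg z k)%:R.
Proof.
rewrite mxE natr_sum; congr (_ * _); apply: eq_bigr => i _.
by rewrite natr_sum.
Qed.

(** The margin [l * d] bounds every [kdeg z k0], so raising the weight of [k0] by one
    keeps [z0] maximal; subtracting the two divisibilities isolates [kdeg z0 k0]. *)
Lemma exposed_proj_int (s : seq 'rV[R]_m) v d l (B : 'I_m -> 'M[K]_l) z0 :
    extreme_point (Conv [set` s]) v -> (0 < d)%N ->
    z0 \in msupp (\det (blowup d B)) -> v = proj R z0 ->
    (forall z, z \in msupp (\det (blowup d B)) -> proj R z \in s) ->
  forall k, v 0 k \is a Num.int.
Proof.
move=> /extreme_exposed[c c_max] d_gt0 z0_supp v_eq proj_s k0.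
have d_neq0 : d%:R != 0 :> R by rewrite pnatr_eq0 -lt0n.
have dotE (z : 'X_{1..nvars m d}) :
    \sum_k c 0 k * (kdeg z k)%:R = d%:R * dot c (proj R z).
  rewrite /dot mulr_sumr; apply: eq_bigr => k _.
  by rewrite projE mulrCA mulVKf.
have [|C C_max] := @nat_exposing R m _ _ (@kdeg m d) z0 (l * d)%N (c 0)
    (fun z => @kdeg_total K m d l B z) (kdeg_total z0_supp).
  move=> z z_supp; have [eq_v|ne_v] := eqVneq (proj R z) v; [left => k | right].
    have := congr1 (fun u : 'rV_m => u 0 k) eq_v; rewrite v_eq !projE.
    by move=> /(mulfI (invr_neq0 d_neq0))/eqP; rewrite eqr_nat => /eqP.
  by rewrite !dotE ltr_pM2l ?ltr0n // -v_eq c_max ?proj_s.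
have kdeg_le z k : z \in msupp (\det (blowup d B)) -> (kdeg z k <= l * d)%N.
  by move/kdeg_total <-; rewrite (bigD1 k) //= leq_addr.
have dvdC : (d %| weight C z0)%N.
  apply: (dvd_max_weight d_gt0 z0_supp) => z z_supp.
  have [eq_w|] := C_max z z_supp; last by apply: leq_trans; rewrite leq_addr.
  by rewrite leq_eqVlt; apply/orP; left; apply/eqP/eq_bigr => k _; rewrite eq_w.
pose C' k := (C k + (k == k0))%N.
have weightC' z : weight C' z = (weight C z + kdeg z k0)%N.
  rewrite /weight /C'; under eq_bigr do rewrite mulnDl.
  rewrite big_split; congr (_ + _)%N.
  rewrite (bigD1 k0) //= eqxx mul1n big1 ?addn0 // => k.
  by move/negPf->.
have dvdC' : (d %| weight C' z0)%N.
  apply: (dvd_max_weight d_gt0 z0_supp) => z z_supp; rewrite !weightC'.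
  have [eq_w|le_w] := C_max z z_supp.
    have -> : weight C z = weight C z0 by apply: eq_bigr => k _; rewrite eq_w.
    by rewrite eq_w.
  apply: (@leq_trans (weight C z0)); last exact: leq_addr.
  by apply: leq_trans le_w; rewrite leq_add2l kdeg_le.
have /dvdnP[q kq] : (d %| kdeg z0 k0)%N by rewrite -(dvdn_addr _ dvdC) -weightC'.
by rewrite v_eq projE kq natrM mulrCA mulVf // mulr1 natr_int.
Qed.

Lemma finite_Sset n (A : 'I_m -> 'M[K]_n) d l : finite_set (Sset R A d l).
Proof.
pose F (IJ : {set 'I_n} * {set 'I_n}) : set 'rV[R]_m :=
  [set v | exists (hI : #|IJ.1| = l) (hJ : #|IJ.2| = l),
     exists2 z : 'X_{1..nvars m d},
       z \in msupp (\det (blowup d (fun k => submat hI hJ (A k)))) & v = proj R z].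
apply: (@sub_finite_set _ _ (\bigcup_IJ F IJ)).
  by move=> v [I [J h]]; exists (I, J).
apply: bigcup_finite => // -[I J] _.
have [hI|hI] := pselect (#|I| = l); last by apply: (sub_finite_set _ (@finite_set0 _)) => v [].
have [hJ|hJ] := pselect (#|J| = l); last by apply: (sub_finite_set _ (@finite_set0 _)) => v [? []].
apply: (@sub_finite_set _ _
  [set` [seq proj R z | z <- msupp (\det (blowup d (fun k => submat hI hJ (A k))))]]).
  move=> v [hI' [hJ' [z z_supp ->]]] /=; apply: map_f.
  by rewrite (eq_irrelevance hI hI') (eq_irrelevance hJ hJ').
exact: finite_seq.
Qed.

(** The three polytopes are hulls of unions of sets [Sset R A d l].  An extreme
    point belongs to one of these sets, and its integrality follows from its
    extremality among the monomials of a single minor. *)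
Lemma integral_Conv n (A : 'I_m -> 'M[K]_n) (S : set 'rV[R]_m) :
  finite_set S ->
  (forall v, S v -> exists d l, [/\ (0 < d)%N, Sset R A d l v & Sset R A d l `<=` S]) ->
  integral_polytope (Conv S).
Proof.
move=> /finite_seqP[s S_eq] S_cover; split; first by exists s; rewrite -S_eq.
move=> v v_ext; have := S_cover v (extreme_mem v_ext).
move=> [d [l [d_gt0 [I [J [hI [hJ [z0 z0_supp v_eq]]]]] sub_S]]].
rewrite S_eq in v_ext.
apply: (exposed_proj_int v_ext d_gt0 z0_supp v_eq) => z z_supp.
have : S (proj R z) by apply: sub_S; exists I, J, hI, hJ, z.
by rewrite S_eq.
Qed.
End Integrality.

Theorem theorem3p1 (R : realType) (K : fieldType) (m n : nat)
    (A : 'I_m -> 'M[K]_n) (d l : nat) (hd : (1 <= d)%N) (hl : (l <= n)%N) :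
  [/\ integral_polytope (Pdl R A d l),
      integral_polytope (Pd R A d)
    & integral_polytope (Pled R A d)].
Proof.
have fin_d f : finite_set (\bigcup_(l in [set l | (l <= n)%N]) Sset R A f l)%classic.
  by apply: bigcup_finite => [|k _]; [apply: (finite_II n.+1) | apply: finite_Sset].
split; apply: (integral_Conv (A := A)).
- exact: finite_Sset.
- by move=> v Sv; exists d, l; split.
- exact: fin_d.
- by move=> v [k le_kn Sv]; exists d, k; split=> // x Sx; exists k.
- apply: bigcup_finite => [|f _]; last exact: fin_d.
  by apply: sub_finite_set (finite_II d.+1) => f /andP[].
- move=> v [f f_range [k le_kn Sv]]; exists f, k.
  by have /andP[f_gt0 _] := f_range; split=> // x Sx; exists f => //; exists k.
Qed.
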